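(* For each fixed $k\in\mathbb{N}$, \textsc{$k$-Tournament-Inversion} can be solved for $n$-vertex tournaments in time $O(n^2)$. Moreover, there is such an algorithm which, if the input tournament is $k$-invertible, finds a decycling family of it of size at most $k$.
   Context: For a digraph $D$ and $X\subseteq V(D)$, inverting $X$ in $D$ means reversing the direction of every edge with both endpoints in $X$. A family $X_1,\dots,X_k\subseteq V(D)$ is a decycling family of $D$ if inverting $X_1,\dots,X_k$ in turn yields an acyclic digraph; $\operatorname{inv}(D)$ is the minimum size of a decycling family, and $D$ is $k$-invertible if $\operatorname{inv}(D)\leq k$. For fixed $k$, \textsc{$k$-Tournament-Inversion} is the decision problem: given a tournament $T$, decide whether $\operatorname{inv}(T)\leq k$. *)

(* Defs.v *)
From mathcomp Require Import all_boot.

Set Implicit Arguments.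
Unset Strict Implicit.
Unset Printing Implicit Defensive.

Section Digraphs.
Variable V : finType.
Implicit Types (D : rel V) (X : {set V}) (Xs : seq {set V}) (k m : nat).

Definition tournament D : Prop :=
  irreflexive D /\ forall x y, x != y -> D x y = ~~ D y x.

(* Loops and directed 2-cycles count as cycles. *)
Definition acyclic D : Prop := forall c : seq V, ucycle D c -> c = [::].

Definition invert D X : rel V :=
  fun x y => if (x \in X) && (y \in X) then D y x else D x y.

Definition decycling D Xs : Prop := acyclic (foldl invert D Xs).

(* "inv(D) = m".  A relation, because a digraph with a loop or a directed
   2-cycle has no decycling family and hence no inversion number. *)
Definition inv_is D m : Prop :=
  (exists2 Xs, decycling D Xs & size Xs = m) /\
  (forall Xs, decycling D Xs -> m <= size Xs).

Definition invertible k D : Prop := exists2 m, inv_is D m & m <= k.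

End Digraphs.

(* Algorithms are programs for a word RAM with w-bit words, written in a
   structured language with finitely many registers and a memory addressed by
   words.  A program is a finite piece of syntax that depends neither on the
   input nor on w; every operation on words costs one unit of time. *)

Inductive binop := OpAdd | OpSub | OpMul | OpDiv | OpMod | OpEq | OpLt.

Inductive expr :=
  | Const of nat
  | Reg of nat
  | Cell of expr
  | Bin of binop & expr & expr.

Inductive cmd :=
  | Skip
  | Assign of nat & expr
  | Store of expr & expr               (* address, value *)
  | Seq of cmd & cmd
  | If of expr & cmd & cmd
  | While of expr & cmd.

Record state := State { reg : nat -> nat; mem : nat -> nat }.

Definition set_reg s x v : state :=
  State [eta reg s with x |-> v] (mem s).
Definition set_mem s a v : state :=
  State (reg s) [eta mem s with a |-> v].

(* Results are reduced modulo 2 ^ w; subtraction is truncated at 0. *)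
Definition eval_binop (w : nat) (o : binop) (a b : nat) : nat :=
  match o with
  | OpAdd => (a + b) %% 2 ^ w
  | OpSub => a - b
  | OpMul => (a * b) %% 2 ^ w
  | OpDiv => a %/ b
  | OpMod => a %% b
  | OpEq => a == b
  | OpLt => a < b
  end.

Fixpoint eval (w : nat) (s : state) (e : expr) : nat :=
  match e with
  | Const c => c %% 2 ^ w
  | Reg x => reg s x
  | Cell a => mem s (eval w s a)
  | Bin o e1 e2 => eval_binop w o (eval w s e1) (eval w s e2)
  end.

Fixpoint cost (e : expr) : nat :=
  match e with
  | Const _ | Reg _ => 1
  | Cell a => (cost a).+1
  | Bin _ e1 e2 => (cost e1 + cost e2).+1
  end.

(* [exec w P s t s']: with w-bit words, P started in state s halts after t
   units of time in state s'. *)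
Inductive exec (w : nat) : cmd -> state -> nat -> state -> Prop :=
  | exec_skip s : exec w Skip s 1 s
  | exec_assign s x e :
      exec w (Assign x e) s (cost e).+1 (set_reg s x (eval w s e))
  | exec_store s a e :
      exec w (Store a e) s (cost a + cost e).+1
           (set_mem s (eval w s a) (eval w s e))
  | exec_seq P Q s s1 s2 t1 t2 :
      exec w P s t1 s1 -> exec w Q s1 t2 s2 ->
      exec w (Seq P Q) s (t1 + t2) s2
  | exec_if_true e P Q s s1 t :
      eval w s e != 0 -> exec w P s t s1 ->
      exec w (If e P Q) s ((cost e).+1 + t) s1
  | exec_if_false e P Q s s1 t :
      eval w s e = 0 -> exec w Q s t s1 ->
      exec w (If e P Q) s ((cost e).+1 + t) s1
  | exec_while_true e P s s1 s2 t1 t2 :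
      eval w s e != 0 -> exec w P s t1 s1 -> exec w (While e P) s1 t2 s2 ->
      exec w (While e P) s ((cost e).+1 + t1 + t2) s2
  | exec_while_false e P s :
      eval w s e = 0 -> exec w (While e P) s (cost e).+1 s.

(* The input is n in register 0 and the n x n adjacency matrix, row by row, in
   memory cells 0, ..., n ^ 2 - 1; everything else is 0. *)
Definition adj_cell (n : nat) (T : rel 'I_n) (a : nat) : nat :=
  [exists i : 'I_n, exists j : 'I_n, (a == i * n + j) && T i j].

Definition input (n : nat) (T : rel 'I_n) : state :=
  State (fun x => if x == 0 then n else 0) (adj_cell T).

(* On n-vertex tournaments, with words of at least c (log n + 1) bits for some
   constant c, P halts within time O(f n), uniformly in the word size, in a
   final state satisfying the specification.  The successor in [(f n).+1] is
   there for the empty tournament, on which running time 0 is impossible. *)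
Definition solves_in_time (f : nat -> nat)
    (spec : forall n, rel 'I_n -> state -> Prop) (P : cmd) : Prop :=
  exists c C : nat,
  forall (n : nat) (T : rel 'I_n) (w : nat),
    tournament T -> c * (up_log 2 n).+1 <= w ->
    exists t s,
      [/\ exec w P (input T) t s, t <= C * (f n).+1 & spec n T s].

Definition accepts (s : state) : Prop := reg s 0 != 0.

Definition decides_inversion (k n : nat) (T : rel 'I_n) (s : state) : Prop :=
  accepts s <-> invertible k T.

(* Register 1 holds the number of sets, and memory from cell 0 on holds their
   characteristic vectors, of n cells each. *)
Definition output_family (n : nat) (s : state) : seq {set 'I_n} :=
  mkseq (fun i => [set j : 'I_n | mem s (i * n + j) != 0]) (reg s 1).

Definition finds_family (k n : nat) (T : rel 'I_n) (s : state) : Prop :=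
  invertible k T ->
  decycling T (output_family n s) /\ size (output_family n s) <= k.

(* Main.v *)
Require Import Defs.
From mathcomp Require Import all_boot zify.

(* Give each vertex x the set lab x of indices of the sets of the family that
   contain it.  The family is decycling iff the tournament T x y (+)
   dot (lab x) (lab y) is transitive, where dot is the parity of the
   intersection.  Vertices are inserted one at a time, keeping labels and the
   resulting transitive order.  For a new vertex v, the old order, with the old
   labels and the adjacencies to v as letters, is a word over a finite alphabet
   that determines all the edges; a new labelling is good iff no three letters
   in increasing positions form a 3-cycle, which a finite automaton checks.
   Computing backwards the sets of winning states of that automaton, and then
   choosing labels forwards, takes linear time per insertion.  The position of a
   vertex in the new order is its indegree, found by counting the letters on
   either side of it.  Since k-invertibility is inherited by subtournaments, the
   first failure is final. *)

Set Implicit Arguments.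
Unset Strict Implicit.
Unset Printing Implicit Defensive.

(** * Inversions and labellings *)

Section TransitiveTournaments.
Variable V : finType.
Implicit Types (D : rel V) (X : {set V}) (Xs : seq {set V}).

(** A failure of transitivity closes a directed 3-cycle, or a 2-cycle if its ends coincide;
    conversely, transitivity shortcuts any cycle to a loop. *)
Lemma acyclic_transitive D : tournament D -> acyclic D <-> transitive D.
Proof.
move=> [irrD torD]; split=> [acD y x z Dxy Dyz | trD [|x p] //].
  have neq a b : D a b -> a != b.
    by move=> Dab; apply: contraTneq Dab => ->; rewrite irrD.
  have xDy := neq _ _ Dxy; have yDz := neq _ _ Dyz.
  have [exz|xDz] := eqVneq x z.
    by move: Dyz; rewrite -exz torD 1?eq_sym // Dxy.
  apply/idPn => nDxz.
  have /acD // : ucycle D [:: x; y; z].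
  by rewrite /ucycle /= Dxy Dyz torD 1?eq_sym // nDxz !inE negb_or xDy xDz yDz.
case/andP=> /= pD _.
have /allP/(_ x) := order_path_min trD pD.
by rewrite mem_rcons mem_head irrD => /(_ isT).
Qed.

Definition both_in x y : pred {set V} := fun X => (x \in X) && (y \in X).

(** Each set containing both ends toggles the edge, so only a parity matters. A diagonal entry never
    changes, whatever the parity, hence [x != y]. *)
Lemma foldl_invert D Xs : tournament D ->
  tournament (foldl (@invert V) D Xs) /\
  forall x y, x != y ->
    foldl (@invert V) D Xs x y = D x y (+) odd (count (both_in x y) Xs).
Proof.
elim: Xs D => [|X Xs IH] D torD /=; first by split=> // x y _; rewrite addbF.
have [irrD torDE] := torD.
have torDX : tournament (invert D X).
  split=> [x|x y xDy]; rewrite /invert ?irrD ?if_same // andbC.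
  by case: ifP => _; rewrite torDE // 1?eq_sym.
have [torI invE] := IH _ torDX; split=> // x y xDy.
rewrite invE // /invert oddD [D y x]torDE 1?eq_sym // /both_in.
by move: (count _ _) => c; case: (_ && _); case: (D x y); case: (odd c).
Qed.

End TransitiveTournaments.

(** * Labelling a word so that an automaton accepts it *)

Section LabelGuessing.
Variables (Q A L : finType) (delta : Q -> A * L -> Q) (q0 : Q) (acc : {set Q}) (l0 : L).

Definition pre (S : {set Q}) (a : A) : {set Q} := [set q | [exists l, delta q (a, l) \in S]].

Definition choose_label (q : Q) (a : A) (S : {set Q}) : L :=
  odflt l0 [pick l | delta q (a, l) \in S].

Variables (N : nat) (a : nat -> A).

Fixpoint run_state (ls : nat -> L) i : Q :=
  if i is j.+1 then delta (run_state ls j) (a j, ls j) else q0.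

(* The states from which the last [i] letters can be labelled so as to reach
   [acc]. *)
Fixpoint winning i : {set Q} :=
  if i is j.+1 then pre (winning j) (a (N - j.+1)) else acc.

Fixpoint greedy_state i : Q :=
  if i is j.+1 then
    let q := greedy_state j in
    delta q (a j, choose_label q (a j) (winning (N - j.+1)))
  else q0.

Definition greedy_label i : L :=
  choose_label (greedy_state i) (a i) (winning (N - i.+1)).

Lemma run_greedy i : run_state greedy_label i = greedy_state i.
Proof. by elim: i => //= i ->. Qed.

(** By definition of [pre], a winning state has a label leading into the next winning set, so the
    pick succeeds at every step. At [i = N] the state lies in [acc]. *)
Lemma greedy_winning i : q0 \in winning N -> i <= N -> greedy_state i \in winning (N - i).
Proof.
move=> q0N; elim: i => [|i IH] iN; first by rewrite subn0.
move: (IH (ltnW iN)); rewrite -(subnSK iN) /= inE.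
(* [winning] counts letters from the end; this identifies the letter it reads here as [a i]. *)
have -> : N - (N - i.+1).+1 = i by lia.
case/existsP=> l dl; rewrite /choose_label.
by case: pickP => [//|/(_ l)]; rewrite dl.
Qed.

Lemma run_winning ls : run_state ls N \in acc -> q0 \in winning N.
Proof.
move=> accN; suff H j : j <= N -> run_state ls (N - j) \in winning j.
  by have := H N (leqnn N); rewrite subnn.
elim: j => [|j IH] jN; first by rewrite subn0.
rewrite /= inE; apply/existsP; exists (ls (N - j.+1)).
by move: (IH (ltnW jN)); rewrite -(subnSK jN).
Qed.

End LabelGuessing.

(* A sequence [X_0, ..., X_(k-1)] of sets is encoded by the function sending
   a vertex to the set of indices [i] such that [X_i] contains it. *)
Section Labels.
Variable k : nat.

Definition label := {set 'I_k}.
Definition dot (l l' : label) : bool := odd #|l :&: l'|.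

Lemma dotC : commutative dot.
Proof. by move=> l l'; rewrite /dot setIC. Qed.

(** The diagonal is excluded because [dot l l] may be true. Vertices are natural numbers so that all
    prefixes of the vertex order share one type. *)
Definition relabel (E : rel nat) (lab : nat -> label) : rel nat :=
  fun x y => (x != y) && (E x y (+) dot (lab x) (lab y)).

Definition transitive_below m (R : rel nat) : Prop :=
  forall x y z, x < m -> y < m -> z < m -> R x y -> R y z -> R x z.

Definition tournament_below m (E : rel nat) : Prop :=
  forall x y, x < m -> y < m -> x != y -> E x y = ~~ E y x.

Definition labelable E m : Prop :=
  exists lab, transitive_below m (relabel E lab).

Lemma labelable_leq E m m' : m <= m' -> labelable E m' -> labelable E m.
Proof.
move=> le_mm [lab tr]; exists lab => x y z xm ym zm.
by apply: tr; apply: leq_trans le_mm.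
Qed.

Definition adjacent n (T : rel 'I_n) : rel nat :=
  fun x y => [exists i : 'I_n, exists j : 'I_n, [&& x == i, y == j & T i j]].

Lemma adjacentE n (T : rel 'I_n) (i j : 'I_n) : adjacent T i j = T i j.
Proof.
apply/existsP/idP => [[i' /existsP[j' /and3P[/eqP/val_inj-> /eqP/val_inj->]]]|Tij] //.
by exists i; apply/existsP; exists j; rewrite !eqxx.
Qed.

Lemma adj_cellE n (T : rel 'I_n) x y : y < n ->
  adj_cell T (x * n + y) = adjacent T x y.
Proof.
move=> yn; rewrite /adj_cell /adjacent; congr nat_of_bool.
apply: eq_existsb => i; apply: eq_existsb => j; rewrite andbA; congr (_ && _).
apply/eqP/andP => [e|[/eqP-> /eqP->] //].
have jn := ltn_ord j; have n0 : 0 < n by apply: leq_ltn_trans yn.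
have := congr1 (divn^~ n) e; have := congr1 (modn^~ n) e.
rewrite /= !modnMDl !modn_small // !divnMDl // !divn_small // !addn0.
by move=> -> ->.
Qed.

Lemma adjacent_tournament n (T : rel 'I_n) :
  tournament T -> tournament_below n (adjacent T).
Proof.
move=> [_ torT] x y xn yn xDy.
by rewrite (adjacentE T (Ordinal xn) (Ordinal yn))
  (adjacentE T (Ordinal yn) (Ordinal xn)) torT.
Qed.

(** Families and labels meet here: both sides toggle each edge by the same parity, and an acyclic
    tournament is a transitive one. *)
Lemma decycling_relabel n (T : rel 'I_n) Xs (lab : nat -> label) : tournament T ->
  (forall x y : 'I_n, odd (count (both_in x y) Xs) = dot (lab x) (lab y)) ->
  decycling T Xs <-> transitive_below n (relabel (adjacent T) lab).
Proof.
move=> torT countE; have [torI invE] := foldl_invert Xs torT.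
have RE (x y : 'I_n) : foldl (@invert 'I_n) T Xs x y = relabel (adjacent T) lab x y.
  rewrite /relabel adjacentE; have [<-|xDy] := eqVneq x y.
    by rewrite eqxx (proj1 torI).
  by rewrite val_eqE xDy invE // countE.
rewrite /decycling acyclic_transitive //; split=> trR.
  move=> x y z xn yn zn.
  by have := trR (Ordinal yn) (Ordinal xn) (Ordinal zn); rewrite !RE.
by move=> y x z; rewrite !RE; apply: trR.
Qed.

Definition bit (l : label) (i : nat) : bool := [exists j in l, val j == i].

Lemma bit_ord l (i : 'I_k) : bit l i = (i \in l).
Proof.
apply/exists_inP/idP => [[j jl /eqP/val_inj<-]|il] //.
by exists i.
Qed.

(** Positions from [size s] up to [k] read the default [x0], which [p] rejects, so they add nothing
    to the count. *)
Lemma count_card (A : Type) (p : pred A) x0 (s : seq A) : size s <= k -> ~~ p x0 ->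
  count p s = #|[set i : 'I_k | p (nth x0 s i)]|.
Proof.
move=> sk px0; rewrite -sum1_count (big_nth x0) big_mkord.
rewrite (big_ord_widen_cond _ (fun i => p (nth x0 s i)) (fun=> 1) sk) sum1_card.
apply: eq_card => i; rewrite !inE unfold_in; case: ltnP => [|le_si]; first by rewrite andbT.
by rewrite nth_default // (negPf px0).
Qed.

Definition family_of n (lab : nat -> label) : seq {set 'I_n} :=
  mkseq (fun i => [set j : 'I_n | bit (lab j) i]) k.

Lemma decycling_family_of n (T : rel 'I_n) lab : tournament T ->
  decycling T (family_of n lab) <-> transitive_below n (relabel (adjacent T) lab).
Proof.
move=> torT; apply: decycling_relabel => // x y; rewrite /dot.
rewrite (@count_card _ _ set0) ?size_mkseq // ?/both_in ?inE //; congr odd.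
by apply: eq_card => i; rewrite inE nth_mkseq // !inE !bit_ord.
Qed.

Lemma invertible_labelable n (T : rel 'I_n) : tournament T ->
  invertible k T <-> labelable (adjacent T) n.
Proof.
move=> torT; split=> [[m [[Xs dec <-] _] mk]|[lab tr]].
  (* A family of fewer than [k] sets is padded with [set0]. *)
  exists (fun x => [set i : 'I_k | [exists j in nth set0 Xs i, val j == x]]).
  apply: (iffLR (decycling_relabel torT _) dec) => x y.
  rewrite (@count_card _ _ set0) // ?/both_in ?inE // /dot; congr odd.
  apply: eq_card => i; rewrite !inE.
  suff E (z : 'I_n) : [exists j in nth set0 Xs i, val j == z] = (z \in nth set0 Xs i).
    by rewrite !E.
  by apply/exists_inP/idP => [[j jX /eqP/val_inj<-]|zX] //; exists z.
(* [invertible] asks for a minimum size; [ex_minnP] provides it from a boolean predicate on sizes,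
   so decycling is restated as a finite check of transitivity. *)
pose R Xs := foldl (@invert 'I_n) T Xs.
pose P m := [exists Xs : m.-tuple {set 'I_n}, [forall x, forall y, forall z,
  R Xs y x ==> R Xs x z ==> R Xs y z]].
have decP Xs : reflect (decycling T Xs) [forall x, forall y, forall z,
    R Xs y x ==> R Xs x z ==> R Xs y z].
  have [torI _] := foldl_invert Xs torT.
  apply: (iffP idP) => [/forallP H|dec].
    apply/acyclic_transitive => // x y z Rxy Ryz.
    by have /forallP/(_ y)/forallP/(_ z) := H x; rewrite /R Rxy Ryz.
  apply/forallP => x; apply/forallP => y; apply/forallP => z.
  apply/implyP => Rxy; apply/implyP => Ryz.
  by move: dec; rewrite /decycling acyclic_transitive // => /(_ _ _ _ Rxy Ryz).
have Pk : P k.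
  have szF : size (family_of n lab) == k by rewrite size_mkseq.
  by apply/existsP; exists (Tuple szF); apply/decP/decycling_family_of.
have exP : exists m, P m by exists k.
case: (ex_minnP exP) => m /existsP[Xs decXs] min_m.
exists m; last exact: min_m.
split; first by exists Xs; [apply/decP | rewrite size_tuple].
move=> Ys decYs; apply: min_m; apply/existsP.
by exists (in_tuple Ys); apply/decP.
Qed.

(* A letter records the old label of a vertex together with its adjacency to
   the new vertex, [None] being the new vertex itself, which is put last in
   the old order.  An edge from an earlier to a later position is determined
   by the two letters. *)
Definition letter := option (label * bool).

(** Between old vertices [E] corrected by [dot] points forward in the old order, so [E] itself is
    the negation of [dot]. The two mixed cases agree, which keeps the function symmetric. *)
Definition forward (a a' : letter) : bool :=
  match a, a' with
  | Some (l, _), Some (l', _) => ~~ dot l l'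
  | Some (_, e), None | None, Some (_, e) => e
  | None, None => false
  end.

Definition new_letter := (letter * label)%type.

Definition new_forward (b b' : new_letter) : bool :=
  forward b.1 b'.1 (+) dot b.2 b'.2.

Lemma new_forwardC : commutative new_forward.
Proof.
by move=> [[[l e]|] x] [[[l' e']|] y]; rewrite /new_forward /= (dotC x) ?(dotC l).
Qed.

(** * The tournament on the positions of a word *)

Definition word_rel (b : nat -> new_letter) : rel nat := fun p q =>
  (p < q) && new_forward (b p) (b q) || (q < p) && ~~ new_forward (b p) (b q).

(** Among three increasing positions, a 3-cycle means that the two consecutive edges point the same
    way and the outer edge the other way. *)
Definition cyclic3 (b1 b2 b3 : new_letter) : bool :=
  (new_forward b1 b2 == new_forward b2 b3) && (new_forward b1 b2 != new_forward b1 b3).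

Definition acyclic_word N (b : nat -> new_letter) : Prop :=
  forall p q s, p < q -> q < s -> s < N -> ~~ cyclic3 (b p) (b q) (b s).

Lemma word_relN b p q : p != q -> word_rel b p q = ~~ word_rel b q p.
Proof.
by rewrite /word_rel [new_forward (b q) _]new_forwardC; case: ltngtP => //= _ _; rewrite ?orbF ?negbK.
Qed.

Lemma word_rel_irr b p : word_rel b p p = false.
Proof. by rewrite /word_rel ltnn. Qed.

Lemma acyclic_word_transitive N b :
  acyclic_word N b <-> transitive_below N (word_rel b).
Proof.
split=> [ac p q s pN qN sN | tr p q s pq qs sN].
  have H x y z : x < y -> y < z -> z < N ->
    ~~ ((new_forward (b x) (b y) == new_forward (b y) (b z)) &&
        (new_forward (b x) (b y) != new_forward (b x) (b z))) by apply: ac.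
  have [<- Rpq|pDs] := eqVneq p s.
    rewrite word_relN ?Rpq //; apply: contraTneq Rpq => ->.
    by rewrite word_rel_irr.
  rewrite /word_rel.
  (* One of these six instances lists the positions increasingly, whatever their order; symmetry of
     [new_forward] then aligns the edges. *)
  have := (H p q s, H p s q, H q p s, H q s p, H s p q, H s q p).
  rewrite ![new_forward (b q) (b p)]new_forwardC ![new_forward (b s) _]new_forwardC.
  case: (ltngtP p q) => [pq|qp|<-] //; case: (ltngtP q s) => [qs|sq|<-] //;
   case: (ltngtP p s) => [ps|sp|eps] //=; try (by rewrite eps eqxx in pDs); rewrite ?pN ?qN ?sN; try lia;
   case: (new_forward (b p) (b q)) => //; case: (new_forward (b q) (b s)) => //;
   case: (new_forward (b p) (b s)) => //=; intuition.
have pN : p < N by lia. have qN : q < N by lia.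
apply/negP => /andP[/eqP e]; have ps : p < s by lia.
(* A cyclic triple runs from [p] to [q] to [s] and back, or in reverse; each instance of
   transitivity excludes one of the two. *)
have := tr p q s pN qN sN; have := tr s q p sN qN pN.
rewrite /word_rel pq qs ps [new_forward (b q) (b p)]new_forwardC ![new_forward (b s) _]new_forwardC.
rewrite !ltnNge !(ltnW pq, ltnW qs, ltnW ps) /= -e.
by case: (new_forward _ _); case: (new_forward _ _); intuition.
Qed.

Definition indegree N (b : nat -> new_letter) p := \sum_(q < N) word_rel b q p.

Lemma indegree_lt N b p : p < N -> indegree N b p < N.
Proof.
move=> pN; rewrite /indegree -[ltnRHS]card_ord -sum1_card.
rewrite (bigD1 (Ordinal pN)) //= [ltnRHS](bigD1 (Ordinal pN)) //= word_rel_irr add0n add1n ltnS.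
by apply: leq_sum => q _; case: word_rel.
Qed.

(** In-neighbours of [p] are in-neighbours of [q] by transitivity, and [p] itself is one more. *)
Lemma indegree_mono N b p q : transitive_below N (word_rel b) -> p < N -> q < N ->
  word_rel b p q -> indegree N b p < indegree N b q.
Proof.
move=> tr pN qN Rpq; rewrite /indegree.
rewrite (bigD1 (Ordinal pN)) //= [ltnRHS](bigD1 (Ordinal pN)) //= word_rel_irr Rpq add0n add1n ltnS.
apply: leq_sum => s _; case Rsp: (word_rel b s p) => //.
by rewrite (tr s p q).
Qed.

Lemma indegreeE N b p q : transitive_below N (word_rel b) -> p < N -> q < N ->
  p != q -> word_rel b p q = (indegree N b p < indegree N b q).
Proof.
move=> tr pN qN pDq; apply/idP/idP; first exact: indegree_mono.
apply: contraTT; rewrite word_relN // negbK => Rqp.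
by rewrite -leqNgt ltnW // indegree_mono.
Qed.


(* The letters read so far, the letters that would now complete a cyclic
   triple, and whether no cyclic triple has occurred yet. *)
Definition wstate := ({set new_letter} * {set new_letter} * bool)%type.

Definition wstart : wstate := (set0, set0, true).

Definition wstep (q : wstate) (c : new_letter) : wstate :=
  let: (seen, bad, ok) := q in
  (c |: seen, bad :|: [set d | [exists b in seen, cyclic3 b c d]], ok && (c \notin bad)).

Definition waccept : {set wstate} := [set q | q.2].

(** Letters alone decide whether a triple is cyclic. Remembering sets of letters instead of
    positions therefore suffices, and the number of states depends on [k] only. *)
Lemma run_wstep a ls i (b := fun p => (a p, ls p)) :
  let: (seen, bad, ok) := run_state wstep wstart a ls i in
  [/\ forall c, c \in seen <-> exists2 p, p < i & b p = c,
      forall d, d \in bad <-> exists p q, [/\ p < q, q < i & cyclic3 (b p) (b q) d]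
    & ok <-> acyclic_word i b].
Proof.
elim: i => [|i] /=.
  split=> [c|d|]; rewrite ?inE; split=> //; first by case.
  by case=> p [q []].
case: (run_state _ _ _ _ i) => [[seen bad] ok] [HS HF Hok] /=; split=> [c|d|].
- rewrite !inE; split=> [/orP[/eqP->|/HS[p pi <-]]|[p]].
  + by exists i.
  + by exists p => //; apply: ltnW.
  rewrite ltnS leq_eqVlt => /orP[/eqP-> <-|pi bp]; first by rewrite eqxx.
  by apply/orP; right; apply/HS; exists p.
- rewrite !inE; split=> [/orP[/HF[p [q [pq qi cyc]]]|/exists_inP[c /HS[p pi <-] cyc]]|].
  + by exists p, q; split=> //; apply: ltnW.
  + by exists p, i.
  case=> p [q [pq]]; rewrite ltnS leq_eqVlt => /orP[/eqP qi|qi] cyc; apply/orP.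
    right; apply/exists_inP; exists (b p); last by rewrite -qi.
    by apply/HS; exists p; rewrite // -qi.
  by left; apply/HF; exists p, q.
split=> [/andP[/Hok ac nF] p q s pq qs|ac].
  rewrite ltnS leq_eqVlt => /orP[/eqP si|]; last exact: ac.
  apply: contra nF => cyc; apply/HF; exists p, q; split=> //; rewrite -?si //.
apply/andP; split.
  by apply/Hok => p q s pq qs si; apply: ac => //; apply: ltnW.
by apply/negP => /HF[p [q [pq qi]]]; apply/negP; apply: ac.
Qed.

Lemma run_waccept a ls N :
  run_state wstep wstart a ls N \in waccept <-> acyclic_word N (fun p => (a p, ls p)).
Proof.
by have := run_wstep a ls N; case: (run_state _ _ _ _ _) => [[seen bad] ok] [_ _]; rewrite inE.
Qed.

(** * Inserting a vertex into a labelled transitive order *)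

Definition represents (E : rel nat) m (lab : nat -> label) (pos : nat -> nat) : Prop :=
  (forall x, x < m -> pos x < m) /\
  (forall x y, x < m -> y < m -> x != y ->
     E x y (+) dot (lab x) (lab y) = (pos x < pos y)).

Lemma represents_transitive E m lab pos :
  represents E m lab pos -> transitive_below m (relabel E lab).
Proof.
case=> _ posE x y z xm ym zm; rewrite /relabel.
have [//|xDy] /= := eqVneq x y; have [//|yDz] /= := eqVneq y z.
rewrite (posE x y) // (posE y z) // => xy yz; have [xz|xDz] := eqVneq x z.
  by move: (ltn_trans xy yz); rewrite xz ltnn.
by rewrite posE //; apply: ltn_trans yz.
Qed.

(** Two vertices with equal positions would have no edge between them in either direction after
    relabelling. *)
Lemma represents_inj E m lab pos : tournament_below m E ->
  represents E m lab pos -> {in gtn m &, injective pos}.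
Proof.
move=> torE [_ posE] x y xm ym exy; apply/eqP/idPn => xDy.
have := posE x y xm ym xDy; have := posE y x ym xm; rewrite eq_sym => /(_ xDy).
by rewrite exy ltnn (torE x y) // dotC => <-; case: (E y x); case: dot.
Qed.

Definition letter_of (E : rel nat) m (lab : nat -> label) x : letter :=
  if x == m then None else Some (lab x, E x m).

Section Insertion.
Variables (E : rel nat) (m : nat) (lab : nat -> label) (pos : nat -> nat).
Hypotheses (torE : tournament_below m.+1 E) (reprE : represents E m lab pos).
Hypothesis pos_m : pos m = m.

Lemma insertion_inj : {in gtn m.+1 &, injective pos}.
Proof.
have torE' : tournament_below m E.
  by move=> x y xm ym; apply: torE; apply: ltnW.
have inj := represents_inj torE' reprE; have [posm _] := reprE.
move=> x y; rewrite !inE !ltnS (leq_eqVlt x) (leq_eqVlt y).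
move=> /orP[/eqP->|xm] /orP[/eqP->|ym] //; rewrite ?pos_m => exy.
- by have := posm y ym; rewrite -exy ltnn.
- by have := posm x xm; rewrite exy ltnn.
- exact: inj.
Qed.

Lemma insertion_lt x : x < m.+1 -> pos x < m.+1.
Proof.
rewrite ltnS leq_eqVlt => /orP[/eqP->|xm]; first by rewrite pos_m.
by apply: ltnW; have [posm _] := reprE; apply: posm.
Qed.

Lemma insertion_surj p : p < m.+1 -> exists2 x, x < m.+1 & pos x = p.
Proof.
move=> pm; pose f (i : 'I_m.+1) := Ordinal (insertion_lt (ltn_ord i)).
have injf : injective f.
  move=> i j [] eij; apply: val_inj.
  by apply: insertion_inj eij; rewrite inE.
have /codomP[i /(congr1 val) /= ->] : Ordinal pm \in codom f.
  by apply: inj_card_onto injf _ _.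
by exists i.
Qed.

Variable ord : nat -> nat.
Hypothesis posK : forall x, x < m.+1 -> ord (pos x) = x.

Lemma vertex_atK p : p < m.+1 -> pos (ord p) = p.
Proof. by move=> /insertion_surj[x xm <-]; rewrite posK. Qed.

Lemma vertex_at_lt p : p < m.+1 -> ord p < m.+1.
Proof. by move=> /insertion_surj[x xm <-]; rewrite posK. Qed.

Lemma vertex_at_inj p q : p < m.+1 -> q < m.+1 -> (ord p == ord q) = (p == q).
Proof.
move=> pm qm; apply/eqP/eqP => [|-> //] e.
by rewrite -(vertex_atK pm) e vertex_atK.
Qed.

Let a p : letter := letter_of E m lab (ord p).

Lemma forward_letter p q : p < q -> q < m.+1 -> E (ord p) (ord q) = forward (a p) (a q).
Proof.
move=> pq qm; have pm := ltn_trans pq qm.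
(* The earlier vertex is not the new one, which occupies the last position [m]. *)
have pDm : (ord p == m) = false.
  apply: contraTF (pq) => /eqP e; move: (vertex_atK pm); rewrite e pos_m => <-.
  by rewrite -leqNgt.
rewrite /a /letter_of pDm; have [-> //|qDm] := eqVneq (ord q) m.
have [_ posE] := reprE; have pqD : ord p != ord q by rewrite vertex_at_inj // ltn_eqF.
have := posE (ord p) (ord q); rewrite !vertex_atK // pq => H /=.
have {}H : E (ord p) (ord q) (+) dot (lab (ord p)) (lab (ord q)).
  by apply: H => //; rewrite ltn_neqAle -ltnS vertex_at_lt ?pDm ?qDm.
by move: H; case: E => //=; case: dot.
Qed.

Lemma relabel_word ls p q : p < m.+1 -> q < m.+1 ->
  relabel E (ls \o pos) (ord p) (ord q) = word_rel (fun i => (a i, ls i)) p q.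
Proof.
move=> pm qm; rewrite /relabel vertex_at_inj //= !vertex_atK //.
have [->|pDq] /= := eqVneq p q; first by rewrite word_rel_irr.
have [pq|qp|e] := ltngtP p q; last by rewrite e eqxx in pDq.
  by rewrite /word_rel pq ltnNge (ltnW pq) orbF /new_forward /= forward_letter.
rewrite /word_rel qp ltnNge (ltnW qp) /= new_forwardC /new_forward /= -forward_letter //.
by rewrite torE ?vertex_at_lt ?vertex_at_inj // dotC addNb.
Qed.

Let start_wins := wstart \in winning wstep waccept m.+1 a m.+1.
Let ls : nat -> label := greedy_label wstep wstart waccept set0 m.+1 a.

(** All old vertices may change their labels, so any labelling of the first [m.+1] vertices, read
    along [ord], labels this word. A losing start thus excludes every labelling, not only those
    extending [lab]. *)
Lemma insertion_unlabelable : ~~ start_wins -> ~ labelable E m.+1.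
Proof.
move=> nwin [lab' tr]; case/negP: nwin.
apply: (@run_winning _ _ _ _ _ _ _ _ (lab' \o ord)).
apply/run_waccept/acyclic_word_transitive => p q s pm qm sm.
rewrite -!relabel_word //.
have relE x y : x < m.+1 -> y < m.+1 ->
    relabel E ((lab' \o ord) \o pos) x y = relabel E lab' x y.
  by move=> xm ym; rewrite /relabel /= !posK.
by rewrite !relE ?vertex_at_lt //; apply: tr; rewrite ?vertex_at_lt.
Qed.

(** The greedy labels make the word transitive, and comparing indegrees recovers the edges of a
    transitive tournament. *)
Lemma insertion_represents : start_wins ->
  represents E m.+1 (ls \o pos) (indegree m.+1 (fun i => (a i, ls i)) \o pos).
Proof.
move=> win; have tr : transitive_below m.+1 (word_rel (fun i => (a i, ls i))).
  apply/acyclic_word_transitive/run_waccept.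
  rewrite run_greedy; have := greedy_winning set0 win (leqnn m.+1).
  by rewrite subnn.
split=> [x xm|x y xm ym xDy] /=; first by apply/indegree_lt/insertion_lt.
have := relabel_word ls (insertion_lt xm) (insertion_lt ym).
rewrite /relabel !posK // xDy /= => ->; apply: indegreeE => //; try exact: insertion_lt.
by apply: contraNneq xDy => e; rewrite -(posK xm) e posK.
Qed.

End Insertion.

End Labels.

(** * Running programs *)

Section Programs.
Variable w : nat.

Definition halts (s : state) (c : cmd) (t : nat) (Q : state -> Prop) : Prop :=
  exists t' s', [/\ exec w c s t' s', t' <= t & Q s'].

Lemma halts_weaken s c t t' (Q Q' : state -> Prop) : t <= t' -> (forall s', Q s' -> Q' s') ->
  halts s c t Q -> halts s c t' Q'.
Proof.
move=> tt' QQ' [u [s' [ex ut Qs']]]; exists u, s'; split=> //; last exact: QQ'.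
exact: leq_trans tt'.
Qed.

Lemma halts_seq s c c' t t' P Q : halts s c t P ->
  (forall s1, P s1 -> halts s1 c' t' Q) -> halts s (Seq c c') (t + t') Q.
Proof.
move=> [u [s1 [ex ut Ps1]]] /(_ s1 Ps1) [u' [s2 [ex' ut' Qs2]]].
exists (u + u'), s2; split=> //; last exact: leq_add.
exact: exec_seq ex ex'.
Qed.

Lemma halts_if (b : bool) s e c c' t Q : eval w s e = b ->
  (b -> halts s c t Q) -> (~~ b -> halts s c' t Q) ->
  halts s (If e c c') ((cost e).+1 + t) Q.
Proof.
case: b => eb Hc Hc'.
  have [u [s' [ex ut Qs']]] := Hc isT; exists ((cost e).+1 + u), s'.
  by split; rewrite ?leq_add2l //; apply: exec_if_true; rewrite // eb.
have [u [s' [ex ut Qs']]] := Hc' isT; exists ((cost e).+1 + u), s'.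
by split; rewrite ?leq_add2l //; apply: exec_if_false; rewrite // eb.
Qed.

(** Keeping bounds in the form [X * t], with [t] independent of [n], carries the linear or quadratic
    factor [X] along once. *)
Lemma halts_seq_scale X s c c' t t' P Q : halts s c (X * t) P ->
  (forall s1, P s1 -> halts s1 c' (X * t') Q) -> halts s (Seq c c') (X * (t + t')) Q.
Proof. by rewrite mulnDr; apply: halts_seq. Qed.

Lemma halts_if_scale X (b : bool) s e c c' t Q : 0 < X -> eval w s e = b ->
  (b -> halts s c (X * t) Q) -> (~~ b -> halts s c' (X * t) Q) ->
  halts s (If e c c') (X * ((cost e).+1 + t)) Q.
Proof.
move=> X0 eb Hc Hc'; apply: halts_weaken (halts_if eb Hc Hc') => //.
by rewrite mulnDr leq_add2r leq_pmull.
Qed.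

Lemma halts_assign s x e v Q : eval w s e = v -> Q (set_reg s x v) ->
  halts s (Assign x e) (cost e).+1 Q.
Proof. by move=> <- Qs; exists (cost e).+1, (set_reg s x (eval w s e)); split=> //; constructor. Qed.

Definition For (r : nat) (hi : expr) (body : cmd) : cmd :=
  Seq (Assign r (Const 0))
    (While (Bin OpLt (Reg r) hi) (Seq body (Assign r (Bin OpAdd (Reg r) (Const 1))))).

(** [Inv i] describes the state at the loop test with counter [i]. The bound [N < 2 ^ w] keeps the
    increment from wrapping around; [N.+1] pays for the final failing test, and 10 for the counter
    handling of a round. *)
Lemma halts_for s r hi body N C (Inv : nat -> state -> Prop) : N < 2 ^ w ->
  Inv 0 (set_reg s r 0) ->
  (forall i s', i <= N -> Inv i s' -> reg s' r = i /\ eval w s' hi = N) ->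
  (forall i s', i < N -> Inv i s' ->
     halts s' body C (fun s1 => reg s1 r = i /\ Inv i.+1 (set_reg s1 r i.+1))) ->
  halts s (For r hi body) (N.+1 * (C + cost hi + 10)) (Inv N).
Proof.
move=> Nw Inv0 Inv_reg Inv_step.
pose W := While (Bin OpLt (Reg r) hi) (Seq body (Assign r (Bin OpAdd (Reg r) (Const 1)))).
suff H d i s' : i + d = N -> Inv i s' ->
    halts s' W (d * (C + cost hi + 10) + (cost hi + 5)) (Inv N).
  have H0 : halts s (Assign r (Const 0)) 2 (Inv 0).
    by apply: (halts_assign (e := Const 0)) Inv0; rewrite /= mod0n.
  apply: halts_weaken (halts_seq H0 (fun s1 => H N 0 s1 erefl)) => //.
  by rewrite /=; lia.
elim: d i s' => [|d IH] i s' iN Inv_i.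
  have {}iN : i = N by lia.
  have [ri hN] := Inv_reg i s' ltac:(lia) Inv_i.
  exists (cost (Bin OpLt (Reg r) hi)).+1, s'; split; last by rewrite -iN.
    by apply: exec_while_false; rewrite /= ri hN iN ltnn.
  by rewrite /=; lia.
have iltN : i < N by lia.
have [ri hN] := Inv_reg i s' (ltnW iltN) Inv_i.
have [u [s1 [ex uC [r1 Inv1]]]] := Inv_step i s' iltN Inv_i.
have [u' [s2 [ex' uC' Inv2]]] := IH i.+1 _ ltac:(lia) Inv1.
exists ((cost (Bin OpLt (Reg r) hi)).+1 + (u + (cost (Bin OpAdd (Reg r) (Const 1))).+1) + u'), s2.
split=> //; last by rewrite /=; lia.
apply: exec_while_true ex'; first by rewrite /= ri hN iltN.
apply: exec_seq ex _.
suff -> : i.+1 = eval w s1 (Bin OpAdd (Reg r) (Const 1)) by constructor.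
by rewrite /= r1 (@modn_small 1) ?addn1 ?modn_small //; lia.
Qed.

(** * Straight-line code *)

Fixpoint time (c : cmd) : nat :=
  match c with
  | Assign _ e => (cost e).+1
  | Store a e => (cost a + cost e).+1
  | Seq c c' => time c + time c'
  | _ => 1
  end.

(** Straight-line bodies end in [Skip], so that each rule below consumes one leading command. *)
Definition steps s c (Q : state -> Prop) := halts s c (time c) Q.

Lemma steps_skip s (Q : state -> Prop) : Q s -> steps s Skip Q.
Proof. by exists 1, s; split=> //; constructor. Qed.

Lemma steps_assign s x e v c Q : eval w s e = v -> steps (set_reg s x v) c Q ->
  steps s (Seq (Assign x e) c) Q.
Proof.
by move=> ev Hc; apply: halts_seq (halts_assign ev (erefl (set_reg s x v))) _ => s1 <-.
Qed.

Lemma steps_store s e e' a v c Q : eval w s e = a -> eval w s e' = v ->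
  steps (set_mem s a v) c Q -> steps s (Seq (Store e e') c) Q.
Proof.
move=> ea ev Hc; apply: (halts_seq (P := eq (set_mem s a v))) => [|s1 <- //].
exists (cost e + cost e').+1, (set_mem s a v); split=> //.
by rewrite -ea -ev; constructor.
Qed.

Lemma eval_const s c : c < 2 ^ w -> eval w s (Const c) = c.
Proof. exact: modn_small. Qed.

Lemma eval_add s e e' x y : eval w s e = x -> eval w s e' = y -> x + y < 2 ^ w ->
  eval w s (Bin OpAdd e e') = x + y.
Proof. by move=> /= -> ->; apply: modn_small. Qed.

Lemma eval_mul s e e' x y : eval w s e = x -> eval w s e' = y -> x * y < 2 ^ w ->
  eval w s (Bin OpMul e e') = x * y.
Proof. by move=> /= -> ->; apply: modn_small. Qed.

(* A lookup in a constant table: the sum over [i < N] of [(e == i) * F i]. *)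
Definition select (e : expr) (N : nat) (F : nat -> expr) : expr :=
  foldr (fun i acc => Bin OpAdd (Bin OpMul (Bin OpEq e (Const i)) (F i)) acc)
    (Const 0) (iota 0 N).

(** At most one summand is nonzero, so reduction modulo [2 ^ w] changes no partial sum. *)
Lemma eval_select s e N F i : N <= 2 ^ w -> eval w s e = i -> i < N ->
  eval w s (F i) < 2 ^ w -> eval w s (select e N F) = eval w s (F i).
Proof.
move=> Nw ei iN Fi; rewrite /select.
have : {subset iota 0 N <= gtn N} by move=> j; rewrite mem_iota.
have : uniq (iota 0 N) by apply: iota_uniq.
have : i \in iota 0 N by rewrite mem_iota.
have Hr r : uniq r -> {subset r <= gtn N} ->
    eval w s (foldr (fun i acc => Bin OpAdd (Bin OpMul (Bin OpEq e (Const i)) (F i)) acc)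
      (Const 0) r) = if i \in r then eval w s (F i) else 0.
  elim: r => [|j r IH] /=; first by rewrite mod0n.
  case/andP=> jr ur sub; have jN : j < N by apply: (sub j); rewrite mem_head.
  rewrite IH // => [|x xr]; last by apply: sub; rewrite inE xr orbT.
  rewrite ei (modn_small (leq_trans jN Nw)) inE.
  have [eij|_] := eqVneq i j.
    by rewrite -eij in jr *; rewrite (negPf jr) addn0 modn_mod mul1n modn_small.
  rewrite mul0n mod0n add0n modn_small //; case: ifP => // _.
  exact: leq_ltn_trans Fi.
by move=> ir ur sub; rewrite Hr // ir.
Qed.

Definition code (X : finType) (x : X) : nat := enum_rank x.

Lemma code_inj (X : finType) : injective (@code X).
Proof. by move=> x y /val_inj/enum_rank_inj. Qed.

(** Tables over types that depend on [k] only become expressions of size independent of [n]; this is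
    how the automaton is built into the program. *)
Definition switch (X : finType) (d : X) (e : expr) (F : X -> expr) : expr :=
  select e #|X| (fun i => F (nth d (enum X) i)).

Lemma eval_switch (X : finType) (d x : X) s e F : #|X| <= 2 ^ w -> eval w s e = code x ->
  eval w s (F x) < 2 ^ w -> eval w s (switch d e F) = eval w s (F x).
Proof.
move=> Xw ex Fx; have nx : nth d (enum X) (code x) = x by apply: nth_enum_rank.
by rewrite (eval_select Xw ex (ltn_ord _)) /= nx.
Qed.

Definition switchb (e : expr) (F : bool -> expr) : expr := select e 2 (fun i => F (i == 1)).

Lemma eval_switchb (b : bool) s e F : 1 < 2 ^ w -> eval w s e = b ->
  eval w s (F b) < 2 ^ w -> eval w s (switchb e F) = eval w s (F b).
Proof.
by move=> w1 eb Fb; rewrite /switchb (eval_select w1 eb); case: b eb Fb.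
Qed.

End Programs.

(** * The algorithm *)

Section Algorithm.
Variable k : nat.
Notation label := (label k).
Notation letter := (letter k).
Notation new_letter := (new_letter k).
Notation wstate := (wstate k).
Notation wstep := (@wstep k).
Notation wstart := (wstart k).
Notation waccept := (waccept k).

(* Five arrays, interleaved in the memory above the address in register 2:
   0: position of a vertex, 1: vertex at a position, 2: set of winning states
   at a position, 3: label of a vertex, 4: letter at a position.
   Register 3 holds the number of vertices inserted so far, and register 4
   tells whether they could be labelled.  Register 6 holds a state of the
   automaton or a set of states, register 8 a number of occurrences of the
   letter in register 7; registers 9 to 11 hold a position, a letter, and a
   label or a vertex. *)
Definition array_addr (j : nat) (e : expr) : expr :=
  Bin OpAdd (Reg 2) (Bin OpAdd (Bin OpMul e (Const 5)) (Const j)).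
Definition get j e := Cell (array_addr j e).
Definition put j e v := Store (array_addr j e) v.

Notation "c ;; c'" := (Seq c c') (at level 90, right associativity).

(** * The expressions and loops of the program *)

Definition letter_expr : expr :=
  switchb (Bin OpEq (Reg 10) (Reg 3)) (fun is_new =>
    if is_new then Const (code (None : letter)) else
    switch (set0 : label) (get 3 (Reg 10)) (fun l =>
    switchb (Cell (Bin OpAdd (Bin OpMul (Reg 10) (Reg 0)) (Reg 3))) (fun e =>
      Const (code (Some (l, e) : letter))))).

Definition pre_expr : expr :=
  switch (set0 : {set wstate}) (Reg 6) (fun win =>
  switch (None : letter) (Reg 10) (fun a => Const (code (pre wstep win a)))).

Definition choose_expr : expr :=
  switch wstart (Reg 6) (fun q =>
  switch (None : letter) (Reg 10) (fun a =>
  switch (set0 : {set wstate}) (get 2 (Reg 5)) (fun win =>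
    Const (code (choose_label wstep (set0 : label) q a win))))).

Definition pair_expr : expr :=
  switch (None : letter) (Reg 10) (fun a =>
  switch (set0 : label) (Reg 11) (fun l => Const (code ((a, l) : new_letter)))).

Definition step_expr : expr :=
  switch wstart (Reg 6) (fun q =>
  switch ((None, set0) : new_letter) (Reg 10) (fun b => Const (code (wstep q b)))).

(** The edge into the current position from an occurrence of [c]: read forward if [c] comes before,
    negated if it comes after. *)
Definition weight_expr (after : bool) : expr :=
  switch ((None, set0) : new_letter) (Reg 7) (fun c =>
  switch ((None, set0) : new_letter) (Reg 10) (fun b =>
    Const (new_forward c b (+) after))).

Definition next_m : expr := Bin OpAdd (Reg 3) (Const 1).

Definition order_body : cmd := put 1 (get 0 (Reg 5)) (Reg 5) ;; Skip.

(** Runs from the last position down. The set is stored before being updated by the letter at that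
    position, so it concerns the later letters only, as [choose_expr] requires. *)
Definition win_body : cmd :=
  Assign 9 (Bin OpSub (Reg 3) (Reg 5)) ;;
  put 2 (Reg 9) (Reg 6) ;;
  Assign 10 (get 1 (Reg 9)) ;;
  Assign 10 letter_expr ;;
  put 4 (Reg 9) (Reg 10) ;;
  Assign 6 pre_expr ;; Skip.

(** The old labels are already part of the letters in array 4, so array 3 may be overwritten on the
    way. Array 0 is cleared to accumulate indegrees. *)
Definition greedy_body : cmd :=
  Assign 10 (get 4 (Reg 5)) ;;
  Assign 11 choose_expr ;;
  Assign 9 (get 1 (Reg 5)) ;;
  put 3 (Reg 9) (Reg 11) ;;
  put 0 (Reg 9) (Const 0) ;;
  Assign 10 pair_expr ;;
  put 4 (Reg 5) (Reg 10) ;;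
  Assign 6 step_expr ;; Skip.

(** Register 8 is updated last, so it counts occurrences strictly on one side of the current
    position. *)
Definition rank_body (after : bool) : cmd :=
  Assign 9 (if after then Bin OpSub (Reg 3) (Reg 5) else Reg 5) ;;
  Assign 10 (get 4 (Reg 9)) ;;
  Assign 11 (get 1 (Reg 9)) ;;
  put 0 (Reg 11) (Bin OpAdd (get 0 (Reg 11)) (Bin OpMul (weight_expr after) (Reg 8))) ;;
  Assign 8 (Bin OpAdd (Reg 8) (Bin OpEq (Reg 10) (Reg 7))) ;; Skip.

Definition rank_pass (after : bool) : cmd :=
  Assign 8 (Const 0) ;; For 5 next_m (rank_body after).

(** The new vertex is first put at position [m]. Ranking takes two passes per letter of an alphabet
    whose size depends on [k] only, which avoids comparing all pairs of positions. *)
Definition insert : cmd :=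
  put 0 (Reg 3) (Reg 3) ;;
  For 5 next_m order_body ;;
  Assign 6 (Const (code waccept)) ;;
  For 5 next_m win_body ;;
  If (switch (set0 : {set wstate}) (Reg 6) (fun win => Const (wstart \in win)))
    (Assign 6 (Const (code wstart)) ;;
     For 5 next_m greedy_body ;;
     For 7 (Const #|{: new_letter}|) (rank_pass false ;; rank_pass true))
    (Assign 4 (Const 0)).

Definition output_body : cmd :=
  Store (Reg 5)
    (select (Bin OpDiv (Reg 5) (Reg 0)) k (fun i =>
     switch (set0 : label) (get 3 (Bin OpMod (Reg 5) (Reg 0))) (fun l =>
       Const (bit l i)))) ;; Skip.

(** The base [n * n + k * n] puts the arrays above both the input matrix and the [k * n] output
    cells, which are written from cell 0 on. *)
Definition inversion_algorithm : cmd :=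
  Assign 2 (Bin OpAdd (Bin OpMul (Reg 0) (Reg 0)) (Bin OpMul (Const k) (Reg 0))) ;;
  Assign 4 (Const 1) ;;
  For 3 (Reg 0) (If (Reg 4) insert Skip) ;;
  If (Reg 4)
    (For 5 (Bin OpMul (Const k) (Reg 0)) output_body ;;
     Assign 1 (Const k) ;;
     Assign 0 (Const 1))
    (Assign 0 (Const 0)).

Definition word_const : nat :=
  #|{: wstate}| + #|{: {set wstate}}| + #|{: letter}| + #|{: new_letter}| + #|{: label}| + k + 20.

(** * Memory layout and evaluation without overflow *)

Section Correctness.
Variables (n w : nat) (T : rel 'I_n).
Hypothesis torT : tournament T.
Hypothesis big_word : n * n + k * n + 5 * n + word_const <= 2 ^ w.
Local Notation E := (adjacent T).

Definition slot j p := n * n + k * n + (p * 5 + j).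
Definition array (s : state) j p := Defs.mem s (slot j p).
Definition set_array s j p v := set_mem s (slot j p) v.

Arguments array : simpl never.

Lemma array_reg s x v j p : array (set_reg s x v) j p = array s j p.
Proof. by []. Qed.

Lemma array_set s j p v j' p' : j < 5 -> j' < 5 ->
  array (set_array s j p v) j' p' = if (j' == j) && (p' == p) then v else array s j' p'.
Proof.
move=> j5 j5'; rewrite /array /set_array /= /slot.
case: (eqVneq j' j) => [->|jj] /=; last by rewrite ifF //; lia.
by case: (eqVneq p' p) => [->|pp] /=; rewrite ?eqxx // ifF //; lia.
Qed.

Definition frame m (s : state) : Prop :=
  [/\ reg s 0 = n, reg s 2 = n * n + k * n, reg s 3 = m, reg s 4 = 1
    & forall a, a < n * n -> Defs.mem s a = adj_cell T a].

Lemma frame_reg m s x v : x \notin [:: 0; 2; 3; 4] -> frame m s -> frame m (set_reg s x v).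
Proof.
rewrite !inE !negb_or eq_sym (eq_sym x 2) (eq_sym x 3) (eq_sym x 4).
by case/and4P=> /negPf x0 /negPf x2 /negPf x3 /negPf x4 [? ? ? ? ?]; split; rewrite //= ?x0 ?x2 ?x3 ?x4.
Qed.

Lemma frame_array m s j p v : frame m s -> frame m (set_array s j p v).
Proof.
move=> [? ? ? ? adj]; split=> //= a an; rewrite ifF ?adj //.
by rewrite /slot; lia.
Qed.

Lemma eval_array_addr s e j p : reg s 2 = n * n + k * n -> j < 5 -> p <= n -> eval w s e = p ->
  eval w s (array_addr j e) = slot j p.
Proof.
move=> r2 j5 pn ep; move: big_word; rewrite /word_const => bw.
apply: eval_add => //; last by lia.
apply: eval_add; last by lia.
  by apply: eval_mul => //; rewrite ?eval_const //; lia.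
by apply: eval_const; lia.
Qed.

Lemma eval_get m s e j p : frame m s -> j < 5 -> p <= n -> eval w s e = p ->
  eval w s (get j e) = array s j p.
Proof.
by move=> [_ r2 _ _ _] j5 pn ep; exact: (congr1 (Defs.mem s) (eval_array_addr r2 j5 pn ep)).
Qed.

Lemma steps_put m s e j p e' v c Q : frame m s -> j < 5 -> p <= n ->
  eval w s e = p -> eval w s e' = v ->
  steps w (set_array s j p v) c Q -> steps w s (Seq (put j e e') c) Q.
Proof.
by move=> [_ r2 _ _ _] j5 pn ep ev; apply: steps_store (eval_array_addr r2 j5 pn ep) ev.
Qed.


Lemma card_bound : [/\ #|{: wstate}| <= 2 ^ w, #|{: {set wstate}}| <= 2 ^ w,
  #|{: letter}| <= 2 ^ w, #|{: new_letter}| <= 2 ^ w & #|{: label}| <= 2 ^ w].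
Proof. by move: big_word; rewrite /word_const => bw; split; lia. Qed.

Lemma eval_code (X : finType) (x : X) s : #|X| <= 2 ^ w -> eval w s (Const (code x)) = code x.
Proof. by move=> Xw; rewrite eval_const //; apply: leq_trans Xw; apply: ltn_ord. Qed.

Lemma eval_switch_code (X Y : finType) (d x : X) s e (F : X -> expr) (y : Y) :
  #|X| <= 2 ^ w -> #|Y| <= 2 ^ w -> eval w s e = code x -> eval w s (F x) = code y ->
  eval w s (switch d e F) = code y.
Proof.
move=> Xw Yw ex Fx; rewrite (eval_switch d Xw ex) // Fx.
by apply: leq_trans Yw; apply: ltn_ord.
Qed.

Lemma word_gt1 : 1 < 2 ^ w.
Proof. by move: big_word; rewrite /word_const; lia. Qed.

Lemma eval_switchb_code (Y : finType) (b : bool) s e (F : bool -> expr) (y : Y) :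
  #|Y| <= 2 ^ w -> eval w s e = b -> eval w s (F b) = code y -> eval w s (switchb e F) = code y.
Proof.
move=> Yw eb Fb; rewrite (eval_switchb word_gt1 eb) // Fb.
by apply: leq_trans Yw; apply: ltn_ord.
Qed.

(** * Correctness of the loops of one insertion *)

Section Insertion.
Variables (m : nat) (lab : nat -> label) (pos : nat -> nat).
Hypotheses (ltmn : m < n) (reprE : represents E m lab pos) (pos_m : pos m = m).

Lemma adjacent_tournament_below : tournament_below m.+1 E.
Proof.
move=> x y xm ym; apply: (adjacent_tournament torT); apply: leq_trans ltmn => //.
Qed.

Lemma eval_next_m s : frame m s -> eval w s next_m = m.+1.
Proof.
move: big_word; rewrite /word_const => bw [_ _ r3 _ _].
by rewrite -addn1; apply: eval_add; rewrite ?eval_const //; lia.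
Qed.

Lemma halts_for_m s body (Inv : nat -> state -> Prop) :
  (forall i s', Inv i s' -> frame m s' /\ reg s' 5 = i) ->
  Inv 0 (set_reg s 5 0) ->
  (forall i s', i < m.+1 -> Inv i s' ->
     steps w s' body (fun s1 => reg s1 5 = i /\ Inv i.+1 (set_reg s1 5 i.+1))) ->
  halts w s (For 5 next_m body) (n.+1 * (time body + 13)) (Inv m.+1).
Proof.
move=> Inv_frame Inv0 Inv_step.
(* There are [m.+1] rounds and a last test, and [m < n]. Charging [n.+1] makes the bound uniform
   over all insertions. *)
have le_time : m.+2 * (time body + cost next_m + 10) <= n.+1 * (time body + 13).
  by rewrite -addnA; apply: leq_mul.
apply: halts_weaken le_time (fun _ => id) _.
apply: halts_for => //; first by move: big_word; rewrite /word_const; lia.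
by move=> i s' _ /Inv_frame[fr r5]; split=> //; apply: eval_next_m.
Qed.

Definition order_inv i s : Prop :=
  [/\ frame m s /\ reg s 5 = i, forall x, x < m.+1 -> array s 0 x = pos x,
      forall x, x < m -> array s 3 x = code (lab x)
    & forall x, x < i -> array s 1 (pos x) = x].

Lemma pos_inj : {in gtn m.+1 &, injective pos}.
Proof. exact: insertion_inj adjacent_tournament_below reprE pos_m. Qed.

Lemma pos_lt x : x < m.+1 -> pos x < m.+1.
Proof. exact: insertion_lt reprE pos_m _. Qed.

Lemma order_loop s : frame m s -> (forall x, x < m.+1 -> array s 0 x = pos x) ->
  (forall x, x < m -> array s 3 x = code (lab x)) ->
  halts w s (For 5 next_m order_body) (n.+1 * (time order_body + 13)) (order_inv m.+1).
Proof.
move=> fr arr0 arr3; apply: halts_for_m => [i s' [] //||i s' im].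
  by split=> //; split=> //; apply: frame_reg.
case=> -[fr' r5] a0 a3 a1.
have pn : pos i <= n by have := pos_lt im; lia.
apply: (steps_put (p := pos i) (v := i) fr') => //.
  by rewrite (@eval_get m _ _ _ i) // ?a0 //; lia.
apply: steps_skip; split=> //; split=> [|x xm|x xm|x xi].
- by split=> //; apply: frame_reg => //; apply: frame_array.
- by rewrite array_reg array_set //= a0.
- by rewrite array_reg array_set //= a3.
rewrite array_reg array_set //=.
(* Since [pos] is injective, the write at [pos i] spares the entries of earlier vertices. *)
have [epos|pDp] := eqVneq (pos x) (pos i).
  by apply/esym/pos_inj => //; rewrite inE; lia.
by apply: a1; move: xi; rewrite ltnS leq_eqVlt => /orP[/eqP exi|//]; rewrite exi eqxx in pDp.
Qed.

Variable ord : nat -> nat.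
Hypothesis posK : forall x, x < m.+1 -> ord (pos x) = x.

Let ord_lt := vertex_at_lt adjacent_tournament_below reprE pos_m posK.
Let ord_inj := vertex_at_inj adjacent_tournament_below reprE pos_m posK.

Let a p : letter := letter_of E m lab (ord p).
Let win i : {set wstate} := winning wstep waccept m.+1 a i.

Definition word_inv s : Prop := frame m s /\ forall p, p < m.+1 -> array s 1 p = ord p.

Definition win_inv i s : Prop :=
  [/\ word_inv s, reg s 5 = i, reg s 6 = code (win i),
      forall x, x < m -> array s 3 x = code (lab x)
    & forall p, p < m.+1 -> m < p + i -> array s 2 p = code (win (m - p)) /\ array s 4 p = code (a p)].

Lemma eval_letter s x : frame m s -> x < m.+1 -> reg s 10 = x ->
  (forall x, x < m -> array s 3 x = code (lab x)) ->
  eval w s letter_expr = code (letter_of E m lab x).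
Proof.
move=> fr xm r10 a3; have [r0 _ r3 _ adj] := fr; have [_ _ ltw _ lbw] := card_bound.
have bw := big_word; rewrite /word_const in bw.
apply: (eval_switchb_code (b := x == m)) => //; first by rewrite /= r10 r3.
rewrite /letter_of; have [_|xDm] := eqVneq x m; first exact: eval_code.
have ltxm : x < m by rewrite ltn_neqAle xDm -ltnS.
apply: (@eval_switch_code _ _ _ (lab x) _ _ _ _) => //.
  by rewrite (@eval_get m _ _ _ x) // ?a3 //; lia.
apply: (eval_switchb_code (b := E x m)) => //; last exact: eval_code.
have xn : x * n + n <= n * n by rewrite -mulSnr leq_mul2r; lia.
rewrite /= r10 r0 r3 (@modn_small (x * n)) ?modn_small; try lia.
by rewrite adj ?adj_cellE //; lia.
Qed.

Lemma word_inv_reg s x v : x \notin [:: 0; 2; 3; 4] -> word_inv s -> word_inv (set_reg s x v).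
Proof. by move=> xP [fr a1]; split=> //; apply: frame_reg. Qed.

Lemma word_inv_array s j p v : j < 5 -> j != 1 -> word_inv s -> word_inv (set_array s j p v).
Proof.
move=> j5 j1 [fr a1]; split; first exact: frame_array.
by move=> q qm; rewrite array_set // eq_sym (negPf j1) a1.
Qed.

Lemma win_loop s : word_inv s -> reg s 6 = code waccept ->
  (forall x, x < m -> array s 3 x = code (lab x)) ->
  halts w s (For 5 next_m win_body) (n.+1 * (time win_body + 13)) (win_inv m.+1).
Proof.
move=> wi r6 arr3; have [sw ssw lw nlw _] := card_bound.
apply: halts_for_m => [i s' [[fr _] r5 _ _ _] //||i s' im].
  by split=> // p pm mp; lia.
case=> wi' r5 r6' a3 a24; set p := m - i.
have [[_ _ r3 _ _] a1] := wi'.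
have pm : p < m.+1 by rewrite /p; lia.
have pn : p <= n by lia.
apply: (steps_assign (v := p)); first by rewrite /= r5 r3.
set s1 := set_reg _ _ _; have wi1 : word_inv s1 by apply: word_inv_reg.
apply: (steps_put (p := p) (v := code (win i)) (proj1 wi1)) => //.
set s2 := set_array _ _ _ _; have wi2 : word_inv s2 by apply: word_inv_array.
apply: (steps_assign (v := ord p)).
  by rewrite (@eval_get m _ _ _ p) //; [apply: (proj2 wi2) | case: wi2].
set s3 := set_reg _ _ _; have wi3 : word_inv s3 by apply: word_inv_reg.
apply: (steps_assign (v := code (a p))).
  apply: eval_letter; first by case: wi3.
  - exact: ord_lt.
  - by [].
  by move=> x xm; rewrite array_reg array_set //= array_reg a3.
set s4 := set_reg _ _ _; have wi4 : word_inv s4 by apply: word_inv_reg.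
apply: (steps_put (p := p) (v := code (a p)) (proj1 wi4)) => //.
set s5 := set_array _ _ _ _; have wi5 : word_inv s5 by apply: word_inv_array.
(* The letter read by [winning] at [i.+1] is at position [m.+1 - i.+1], which is [p]. *)
apply: (steps_assign (v := code (win i.+1))).
  apply: (@eval_switch_code _ _ _ (win i) _ _ _ _) => //.
  apply: (@eval_switch_code _ _ _ (a p) _ _ _ _) => //.
  by rewrite eval_code.
apply: steps_skip; split=> //; split=> //.
  by move=> x xm; rewrite !array_reg array_set //= !array_reg array_set //= array_reg a3.
move=> q qm qi; rewrite !array_reg !array_set //= !array_reg !array_set //= !array_reg.
have [->|qDp] := eqVneq q p; first by rewrite /p subKn.
by apply: a24 => //; move: qDp; rewrite /p; lia.
Qed.

Let gst i : wstate := greedy_state wstep wstart waccept (set0 : label) m.+1 a i.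
Let gl p : label := greedy_label wstep wstart waccept (set0 : label) m.+1 a p.
Let b p : new_letter := (a p, gl p).

Definition greedy_inv i s : Prop :=
  [/\ word_inv s, reg s 5 = i, reg s 6 = code (gst i),
      forall p, p < m.+1 -> array s 2 p = code (win (m - p))
    & forall p, p < m.+1 -> if p < i then
        [/\ array s 4 p = code (b p), array s 3 (ord p) = code (gl p) & array s 0 (ord p) = 0]
      else array s 4 p = code (a p)].

Lemma greedy_loop s : word_inv s -> reg s 6 = code wstart ->
  (forall p, p < m.+1 -> array s 2 p = code (win (m - p)) /\ array s 4 p = code (a p)) ->
  halts w s (For 5 next_m greedy_body) (n.+1 * (time greedy_body + 13)) (greedy_inv m.+1).
Proof.
move=> wi r6 arr; have [sw ssw lw nlw lbw] := card_bound.
apply: halts_for_m => [i s' [[fr _] r5 _ _ _] //||i s' im].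
  by split=> // p /arr[].
case=> wi' r5 r6' a2 a430.
have lt_n : i <= n by lia.
have ord_n : ord i <= n by have := ord_lt im; lia.
have a4i := a430 i im; rewrite ltnn in a4i.
apply: (steps_assign (v := code (a i))).
  by rewrite (@eval_get m _ _ _ i) //; case: wi'.
set s1 := set_reg _ _ _; have wi1 : word_inv s1 by apply: word_inv_reg.
apply: (steps_assign (v := code (gl i))).
  apply: (@eval_switch_code _ _ _ (gst i) _ _ _ _) => //.
  apply: (@eval_switch_code _ _ _ (a i) _ _ _ _) => //.
  apply: (@eval_switch_code _ _ _ (win (m - i)) _ _ _ _) => //; last exact: eval_code.
  by rewrite (@eval_get m _ _ _ i) // ?array_reg ?a2 //; case: wi1.
set s2 := set_reg _ _ _; have wi2 : word_inv s2 by apply: word_inv_reg.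
apply: (steps_assign (v := ord i)).
  by rewrite (@eval_get m _ _ _ i) //; [apply: (proj2 wi2) | case: wi2].
set s3 := set_reg _ _ _; have wi3 : word_inv s3 by apply: word_inv_reg.
apply: (steps_put (p := ord i) (v := code (gl i)) (proj1 wi3)) => //.
set s4 := set_array _ _ _ _; have wi4 : word_inv s4 by apply: word_inv_array.
apply: (steps_put (p := ord i) (v := 0) (proj1 wi4)) => //; first by rewrite /= mod0n.
set s5 := set_array _ _ _ _; have wi5 : word_inv s5 by apply: word_inv_array.
apply: (steps_assign (v := code (b i))).
  apply: (@eval_switch_code _ _ _ (a i) _ _ _ _) => //.
  apply: (@eval_switch_code _ _ _ (gl i) _ _ _ _) => //.
  exact: eval_code.
set s6 := set_reg _ _ _; have wi6 : word_inv s6 by apply: word_inv_reg.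
apply: (steps_put (p := i) (v := code (b i)) (proj1 wi6)) => //.
set s7 := set_array _ _ _ _; have wi7 : word_inv s7 by apply: word_inv_array.
apply: (steps_assign (v := code (gst i.+1))).
  apply: (@eval_switch_code _ _ _ (gst i) _ _ _ _) => //.
  apply: (@eval_switch_code _ _ _ (b i) _ _ _ _) => //.
  exact: eval_code.
apply: steps_skip; split=> //; split=> // p pm.
  by rewrite !array_reg array_set //= !array_reg !array_set //= !array_reg a2.
rewrite !array_reg !array_set //= !array_reg !array_set //= !array_reg.
have [->|pDi] := eqVneq p i; first by rewrite leqnn eqxx.
rewrite ord_inj // (negPf pDi) ltnS leq_eqVlt (negPf pDi) /=.
exact: a430.
Qed.

(* The left-to-right pass counts the positions before [p], the right-to-left
   pass ([after]) those after [p]; [visited after i q] means that [q] is among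
   the first [i] positions of the pass. *)
Definition beside (after : bool) (q p : nat) : bool := if after then p < q else q < p.
Definition visited (after : bool) (i q : nat) : bool := if after then m < q + i else q < i.

Definition rank_term after (c : new_letter) p : nat :=
  (new_forward c (b p) (+) after) * \sum_(q < m.+1) (beside after q p && (b q == c)).

Definition letters_inv s : Prop := word_inv s /\ forall p, p < m.+1 ->
  array s 4 p = code (b p) /\ array s 3 (ord p) = code (gl p).

Definition rank_inv after c (init : nat -> nat) i s : Prop :=
  [/\ letters_inv s, reg s 5 = i, reg s 7 = code c,
      reg s 8 = \sum_(q < m.+1) (visited after i q && (b q == c))
    & forall p, p < m.+1 -> array s 0 (ord p) =
        init p + (if visited after i p then rank_term after c p else 0)].

Lemma sum_bool_leq (P : nat -> bool) : \sum_(q < m.+1) P q <= m.+1.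
Proof.
rewrite -[leqRHS]card_ord -sum1_card; apply: leq_sum => q _; exact: leq_b1.
Qed.

Lemma rank_term_leq after c p : rank_term after c p <= m.+1.
Proof.
rewrite /rank_term; case: (_ (+) _); rewrite ?mul0n // mul1n.
exact: (sum_bool_leq (fun q => beside after q p && (b q == c))).
Qed.

Lemma letters_inv_reg s x v : x \notin [:: 0; 2; 3; 4] -> letters_inv s -> letters_inv (set_reg s x v).
Proof. by move=> xP [wi a43]; split=> //; apply: word_inv_reg. Qed.

Lemma letters_inv_array s p v : letters_inv s -> letters_inv (set_array s 0 p v).
Proof.
move=> [wi a43]; split; first exact: word_inv_array.
by move=> q qm; have [a4 a3] := a43 q qm; rewrite !array_set.
Qed.

(** When position [p] is processed, the visited positions are exactly those beside it, so weight
    times counter is [rank_term]. The bound on [init] prevents overflow. *)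
Lemma rank_pass_loop after c init s : letters_inv s -> reg s 7 = code c ->
  (forall p, p < m.+1 -> init p <= 3 * n) ->
  (forall p, p < m.+1 -> array s 0 (ord p) = init p) ->
  halts w s (rank_pass after) (2 + n.+1 * (time (rank_body after) + 13))
    (rank_inv after c init m.+1).
Proof.
move=> li r7 initn arr0; have [sw ssw lw nlw lbw] := card_bound.
have bw := big_word; rewrite /word_const in bw.
apply: halts_seq (halts_assign (v := 0) _ (erefl (set_reg s 8 0))) _ => [|_ <-].
  by rewrite /= mod0n.
have vis0 q : q < m.+1 -> visited after 0 q = false.
  by rewrite /visited; case: (after) => qm; lia.
apply: halts_for_m => [i s' [[[fr _] _] r5 _ _ _] //||i s' im].
  split=> //=.
    by rewrite big1 // => q _; rewrite vis0.
  by move=> p pm; rewrite !array_reg vis0 // addn0 arr0.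
case=> li' r5 r7' r8 a0.
pose p := if after then m - i else i.
have pm : p < m.+1 by rewrite /p; case: (after); lia.
have vis q : q < m.+1 -> visited after i q = beside after q p.
  by rewrite /visited /beside /p; case: (after) => qm; lia.
have visS q : q < m.+1 -> visited after i.+1 q = visited after i q || (q == p).
  by rewrite /visited /p; case: (after) => qm; lia.
have pn : p <= n by lia.
have ord_n : ord p <= n by have := ord_lt pm; lia.
apply: (steps_assign (v := p)).
  by have [[[_ _ r3 _ _] _] _] := li'; rewrite /p; case: (after) => /=; rewrite ?r3 r5.
set s1 := set_reg _ _ _; have li1 : letters_inv s1 by apply: letters_inv_reg.
have fr1 : frame m s1 by have [[]] := li1.
apply: (steps_assign (v := code (b p))).
  by rewrite (@eval_get m _ _ _ p) //; have [_ /(_ p pm)[]] := li1.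
set s2 := set_reg _ _ _; have li2 : letters_inv s2 by apply: letters_inv_reg.
have fr2 : frame m s2 by have [[]] := li2.
apply: (steps_assign (v := ord p)).
  by rewrite (@eval_get m _ _ _ p) //; have [[_ /(_ p pm)]] := li2.
set s3 := set_reg _ _ _; have li3 : letters_inv s3 by apply: letters_inv_reg.
have fr3 : frame m s3 by have [[]] := li3.
have sumE : reg s3 8 = \sum_(q < m.+1) (beside after q p && (b q == c)).
  by rewrite /= r8; apply: eq_bigr => q _; rewrite vis.
have sum_le := sum_bool_leq (fun q => beside after q p && (b q == c)).
have term_le := rank_term_leq after c p.
have init_le := initn p pm.
apply: (steps_put (p := ord p) (v := init p + rank_term after c p) fr3) => //.
  apply: eval_add; last by lia.
    rewrite (@eval_get m _ _ _ (ord p)) // !array_reg a0 //.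
    by rewrite vis // /beside ltnn if_same addn0.
  apply: eval_mul; [|exact: sumE|by move: term_le; rewrite /rank_term; lia].
  have e7 : eval w s3 (Reg 7) = code c by [].
  have e10 : eval w s3 (Reg 10) = code (b p) by [].
  have e2 : (new_forward c (b p) (+) after : nat) < 2 ^ w.
    by apply: leq_ltn_trans (leq_b1 _) _; lia.
  by rewrite (eval_switch _ nlw e7) (eval_switch _ nlw e10) eval_const.
set s4 := set_array _ _ _ _; have li4 : letters_inv s4 by apply: letters_inv_array.
apply: (steps_assign (v := \sum_(q < m.+1) (visited after i.+1 q && (b q == c)))).
  have -> : \sum_(q < m.+1) (visited after i.+1 q && (b q == c))
      = \sum_(q < m.+1) (visited after i q && (b q == c)) + (b p == c).
    rewrite (bigD1 (Ordinal pm)) //= [in RHS](bigD1 (Ordinal pm)) //=.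
    rewrite visS // eqxx orbT vis // /beside ltnn if_same add0n addnC; congr (_ + _).
    apply: eq_bigr => q qDp; rewrite visS // (_ : (val q == p) = false) ?orbF //.
    by apply: contraNF qDp => /eqP e; apply/eqP/val_inj.
  apply: eval_add; [exact: r8 | | ].
    by rewrite /= r7' (inj_eq (@code_inj _)).
  have := sum_bool_leq (fun q => visited after i q && (b q == c)).
  by have := leq_b1 (b p == c); lia.
apply: steps_skip; split=> //; split=> //= q qm.
rewrite !array_reg array_set //= ord_inj // !array_reg.
have [->|qDp] := eqVneq q p; first by rewrite visS // eqxx orbT.
by rewrite a0 // visS // (negPf qDp) orbF.
Qed.

Definition rank_sum i p := \sum_(q < m.+1) ((code (b q) < i) && word_rel b q p).

(** All positions carrying [c] on one side of [p] have the same edge direction towards [p]: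
    [new_forward] from before, its negation from after. *)
Lemma rank_sumS c p :
  rank_sum (code c) p + rank_term false c p + rank_term true c p = rank_sum (code c).+1 p.
Proof.
rewrite /rank_sum /rank_term !big_distrr -!big_split /=; apply: eq_bigr => q _.
rewrite ltnS (leq_eqVlt (code (b q))) (inj_eq (@code_inj _)) /beside /word_rel.
have [<-|_] := eqVneq (b q) c; last by rewrite !andbF !muln0 !addn0.
by rewrite ltnn !andbT addbF addbT; case: (ltngtP q p); case: (new_forward _ _).
Qed.

Lemma rank_sum_max p : rank_sum #|{: new_letter}| p = indegree m.+1 b p.
Proof.
by apply: eq_bigr => q _; rewrite /code ltn_ord.
Qed.

Lemma rank_sum_leq i p : rank_sum i p <= m.+1.
Proof. exact: (sum_bool_leq (fun q => (code (b q) < i) && word_rel b q p)). Qed.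

Definition rank_loop_inv i s : Prop :=
  [/\ letters_inv s, reg s 7 = i & forall p, p < m.+1 -> array s 0 (ord p) = rank_sum i p].

Lemma rank_loop s : letters_inv s -> (forall p, p < m.+1 -> array s 0 (ord p) = 0) ->
  halts w s (For 7 (Const #|{: new_letter}|) (rank_pass false ;; rank_pass true))
    (#|{: new_letter}|.+1 * ((2 + n.+1 * (time (rank_body false) + 13)) +
       (2 + n.+1 * (time (rank_body true) + 13)) + 1 + 10))
    (rank_loop_inv #|{: new_letter}|).
Proof.
move=> li a0; have bw := big_word; rewrite /word_const in bw.
have bw' : #|{: new_letter}| < 2 ^ w by lia.
apply: halts_for => // [|i s' _ [_ -> _]|i s' iB [li' r7 a0']].
- by split=> // p pm; rewrite array_reg a0 // /rank_sum big1.
- by rewrite eval_const.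
pose c : new_letter := enum_val (Ordinal iB).
have ec : code c = i by rewrite /code /c enum_valK.
rewrite -ec in r7 a0' *.
have rank_le p := rank_sum_leq (code c) p; have term_le := rank_term_leq false c.
have pass1 := @rank_pass_loop false c (rank_sum (code c)) s' li' r7.
apply: halts_seq (pass1 _ _) _ => //.
  by move=> p pm; have := rank_le p; lia.
move=> s1 [li1 _ r71 _ a01].
have pass2 := @rank_pass_loop true c
  (fun p => rank_sum (code c) p + rank_term false c p) s1 li1 r71.
apply: halts_weaken (leqnn _) _ (pass2 _ _).
- move=> s2 [li2 _ r72 _ a02]; split=> //; split=> // p pm.
  rewrite array_reg a02 // -rank_sumS /visited ifT //; lia.
- by move=> p pm; have := rank_le p; have := term_le p; lia.
by move=> p pm; rewrite a01 // /visited pm.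
Qed.

End Insertion.

(** * The main loop and the output *)

Definition loop_inv m s : Prop :=
  (frame m s /\ exists lab pos, [/\ represents E m lab pos,
     forall x, x < m -> array s 0 x = pos x
   & forall x, x < m -> array s 3 x = code (lab x : label)]) \/
  [/\ reg s 0 = n, reg s 3 = m, reg s 4 = 0 & ~ labelable k E m].

Definition insert_cost : nat :=
  time (put 0 (Reg 3) (Reg 3)) + (time order_body + 13 + (2 + (time win_body + 13 +
   ((cost (switch (set0 : {set wstate}) (Reg 6) (fun win => Const (wstart \in win)))).+1 +
    (2 + (time greedy_body + 13 + #|{: new_letter}|.+1 * (2 + (time (rank_body false) + 13) +
       (2 + (time (rank_body true) + 13)) + 1 + 10))))))).

Lemma halts_insert m s : m < n -> loop_inv m s -> reg s 4 = 1 ->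
  halts w s insert (n.+1 * insert_cost)
    (fun s' => reg s' 3 = m /\ loop_inv m.+1 (set_reg s' 3 m.+1)).
Proof.
move=> mn [[fr [lab [pos0 [repr0 a0 a3]]]] _|[_ _ -> //]].
have [sw ssw lw nlw lbw] := card_bound.
pose pos x := if x == m then m else pos0 x.
have posE x : x < m -> pos x = pos0 x by move=> xm; rewrite /pos ltn_eqF.
have reprE : represents E m lab pos.
  have [r1 r2] := repr0; split=> [x xm|x y xm ym xDy]; first by rewrite posE // r1.
  by rewrite !posE // r2.
have pos_m : pos m = m by rewrite /pos eqxx.
have [_ _ r3 _ _] := fr.
apply: (halts_seq_scale (P := eq (set_array s 0 m m))).
  apply: halts_weaken (leq_pmull _ (ltn0Sn n)) (fun _ => id) _.
  have r2 : reg s 2 = n * n + k * n by case: fr.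
  have em := eval_array_addr (j := 0) r2 isT (ltnW mn) (r3 : eval w s (Reg 3) = m).
  exists (time (put 0 (Reg 3) (Reg 3))), (set_array s 0 m m); split=> //.
  rewrite /set_array -em -[X in set_mem _ _ X]r3 -[X in set_mem _ _ X]/(eval w s (Reg 3)).
  by constructor.
move=> s1 <-.
apply: halts_seq_scale (order_loop mn reprE pos_m (s := set_array s 0 m m) _ _ _) _ => //.
- exact: frame_array.
- move=> x xm; rewrite array_set //= /pos; case: eqVneq => // xDm.
  by rewrite a0 // ltn_neqAle xDm.
- by move=> x xm; rewrite array_set //= a3.
move=> s2 [[fr2 _] a02 a32 a12].
(* Array 1 of the memory itself serves as the inverse [ord] of [pos]. *)
have posK x : x < m.+1 -> array s2 1 (pos x) = x by apply: a12.
apply: halts_seq_scale (halts_weaken (leq_pmull _ (ltn0Sn n)) (fun _ => id)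
  (halts_assign (eval_code _ _ ssw) (erefl (set_reg s2 6 (code waccept))))) _ => _ <-.
have wi2 : word_inv m (array s2 1) s2 by [].
apply: halts_seq_scale (win_loop mn reprE pos_m posK (s := set_reg s2 6 (code waccept)) _ _ _) _ => //.
move=> s3 [wi3 _ r6 a33 a24].
set win := winning _ _ _ _ _ in r6.
apply: (halts_if_scale (b := wstart \in win)); first by [].
- have e6 : eval w s3 (Reg 6) = code win by [].
  have b_lt (c : bool) : c < 2 ^ w by apply: leq_ltn_trans (leq_b1 _) word_gt1.
  by rewrite (eval_switch _ ssw e6) eval_const.
- move=> start_win.
  apply: halts_seq_scale (halts_weaken (leq_pmull _ (ltn0Sn n)) (fun _ => id)
    (halts_assign (eval_code _ _ sw) (erefl (set_reg s3 6 (code wstart))))) _ => _ <-.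
  apply: halts_seq_scale (greedy_loop mn reprE pos_m posK (s := set_reg s3 6 (code wstart)) _ _ _) _ => //.
    by move=> p pm; apply: a24 => //; lia.
  move=> s4 [wi4 _ _ _ a430].
  have li4 : letters_inv m lab (array s2 1) s4.
    by split=> // p pm; have := a430 p pm; rewrite pm => -[].
  apply: halts_weaken _ _ (rank_loop mn reprE pos_m posK li4 _).
  + rewrite mulnCA leq_mul2l !mulnDr.
    by rewrite !leq_add ?leq_pmull ?orbT.
  + move=> s5 [[[fr5 a15] a435] _ a05]; split; first by case: fr5.
    left; split.
      by have [? ? ? ? ?] := fr5; split.
    eexists; eexists; split.
    * exact: (insertion_represents (adjacent_tournament_below mn) reprE pos_m posK start_win).
    (* The invariants of the last passes are indexed by positions, so [x] is rewritten as the vertex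
       at its position. *)
    * move=> x xm; rewrite array_reg -{1}(posK x xm).
      have px := insertion_lt reprE pos_m xm.
      by rewrite a05 // rank_sum_max.
    move=> x xm; rewrite array_reg -{1}(posK x xm).
    have px := insertion_lt reprE pos_m xm.
    by have [] := a435 _ px.
  by move=> p pm; have := a430 p pm; rewrite pm => -[].
move=> start_loses.
have le_time c : 2 <= n.+1 * (2 + c).
  by rewrite mulnDr; apply: leq_trans (leq_addr _ _); rewrite leq_pmull.
apply: halts_weaken (le_time _) (fun _ => id) _.
apply: (halts_assign (v := 0)); first by rewrite /= mod0n.
have [[r0' _ r3' _ _] _] := wi3.
split=> //; right; split=> //.
exact: (insertion_unlabelable (adjacent_tournament_below mn) reprE pos_m posK start_loses).
Qed.

Lemma output_loop s lab : reg s 0 = n -> reg s 2 = n * n + k * n ->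
  (forall x, x < n -> array s 3 x = code (lab x : label)) ->
  halts w s (For 5 (Bin OpMul (Const k) (Reg 0)) output_body)
    ((k * n).+1 * (time output_body + 3 + 10))
    (fun s' => forall q, q < k * n -> Defs.mem s' q = bit (lab (q %% n)) (q %/ n)).
Proof.
move=> r0 r2 a3; have bw := big_word; rewrite /word_const in bw.
pose Inv i s' := [/\ reg s' 0 = n, reg s' 2 = n * n + k * n, reg s' 5 = i,
  forall x, x < n -> array s' 3 x = code (lab x)
  & forall q, q < i -> Defs.mem s' q = bit (lab (q %% n)) (q %/ n)].
apply: halts_weaken (leqnn _) _ (@halts_for w s 5 _ output_body (k * n) _ Inv _ _ _ _).
- by move=> s' [].
- by lia.
- by [].
- move=> i s' _ [r0' _ r5 _ _]; split=> //.
  by rewrite -r0'; apply: eval_mul; rewrite ?eval_const ?r0' //; lia.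
move=> i s' ikn [r0' r2' r5 a3' memE].
have n0 : 0 < n by case: (n) ikn; rewrite ?muln0.
have modn : i %% n < n by rewrite ltn_mod.
have divk : i %/ n < k by rewrite ltn_divLR.
have [_ _ _ _ lbw] := card_bound.
have ediv : eval w s' (Bin OpDiv (Reg 5) (Reg 0)) = i %/ n by rewrite /= r5 r0'.
have emod : eval w s' (Bin OpMod (Reg 5) (Reg 0)) = i %% n by rewrite /= r5 r0'.
have elab : eval w s' (get 3 (Bin OpMod (Reg 5) (Reg 0))) = code (lab (i %% n)).
  rewrite -a3' //.
  exact: (congr1 (Defs.mem s') (eval_array_addr (j := 3) r2' isT (ltnW modn) emod)).
have b_lt (c : bool) : c < 2 ^ w by apply: leq_ltn_trans (leq_b1 _) word_gt1.
have k_le : k <= 2 ^ w by lia.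
apply: (steps_store (a := i) (v := bit (lab (i %% n)) (i %/ n))) => //.
  by rewrite (eval_select k_le ediv divk); rewrite (eval_switch _ lbw elab) eval_const.
apply: steps_skip; split=> //; split=> // [x xn|q].
  (* The written cell lies below [k * n], and every slot is at least [n * n + k * n]. *)
  rewrite array_reg -a3' // /array /= ifF //.
  by rewrite /slot; lia.
rewrite ltnS leq_eqVlt => /orP[/eqP->|qi]; first by rewrite /= eqxx.
by rewrite /= ltn_eqF // memE.
Qed.

Definition algorithm_cost : nat :=
  (cost (Bin OpAdd (Bin OpMul (Reg 0) (Reg 0)) (Bin OpMul (Const k) (Reg 0)))).+1 +
  (2 + (2 * (13 + insert_cost) + (2 + (k.+1 * (time output_body + 3 + 10) + (2 + 2))))).

Lemma halts_algorithm :
  halts w (input T) inversion_algorithm ((n ^ 2).+1 * algorithm_cost)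
    (fun s => decides_inversion k T s /\ finds_family k T s).
Proof.
have bw := big_word; rewrite /word_const in bw.
have invE := invertible_labelable k torT.
have short c : c <= (n ^ 2).+1 * c by rewrite leq_pmull.
rewrite /algorithm_cost.
pose s1 := set_reg (input T) 2 (n * n + k * n); pose s2 := set_reg s1 4 1.
apply: halts_seq_scale (halts_weaken (short _) (fun _ => id)
  (halts_assign (v := n * n + k * n) _ (erefl s1))) _ => [|_ <-].
  apply: eval_add; [by apply: eval_mul => //=; lia| |by lia].
  by apply: eval_mul; rewrite ?eval_const //; lia.
apply: halts_seq_scale (halts_weaken (short _) (fun _ => id)
  (halts_assign (eval_const s1 word_gt1) (erefl s2))) _ => _ <-.
apply: (halts_seq_scale (P := loop_inv n)).
  (* The factor 2 arises because [n.+1] and [n.+1 * n.+1] are both at most [2 * (n ^ 2).+1]. *)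
  have le_time : n.+1 * ((2 + n.+1 * insert_cost) + 1 + 10) <= (n ^ 2).+1 * (2 * (13 + insert_cost)).
    have le1 : n.+1 <= 2 * (n ^ 2).+1 by nia.
    have le2 : n.+1 * n.+1 <= 2 * (n ^ 2).+1 by nia.
    have -> : n.+1 * (2 + n.+1 * insert_cost + 1 + 10) = n.+1 * 13 + (n.+1 * n.+1) * insert_cost by lia.
    by rewrite mulnCA mulnA mulnDr leq_add // leq_mul2r ?le1 ?le2 orbT.
  apply: halts_weaken le_time (fun _ => id) (@halts_for w s2 3 (Reg 0) _ n _ loop_inv _ _ _ _).
  - by lia.
  - by left; split=> //; exists (fun=> set0), id.
  - by move=> i s' _ [[[]]|[]].
  move=> i s' ltin inv.
  have r4 : eval w s' (Reg 4) = (reg s' 4 == 1) by case: inv => [[[/= _ _ _ ->]]|[/= _ _ ->]].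
  have r3 : reg s' 3 = i by case: inv => [[[]]|[]].
  apply: (halts_if r4) => [/eqP r4'|]; first exact: halts_insert.
  (* After a failure the remaining rounds do nothing, and the failure persists because a labelling
     restricts to prefixes. *)
  case: (inv) => [[[_ _ _ ->]]|[r0' _ r4' nlab] _] //.
  apply: (halts_weaken (t := 1) (Q := eq s')).
  - by rewrite mulSn; apply: leq_trans (leq_addr _ _); rewrite /insert_cost; lia.
  - move=> _ <-; split=> //; right; split=> // lab; apply: nlab.
    by apply: labelable_leq lab.
  - by exists 1, s'; split=> //; constructor.
move=> s [[fr [lab [pos [repr _ a3]]]]|[_ _ r4 nlab]].
  have [r0 r2 _ r4 _] := fr.
  apply: (halts_if_scale (b := true)) => //.
  have dec : decycling T (family_of n lab).
    by apply/decycling_family_of => //; apply: represents_transitive repr.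
  have inv_T : invertible k T by apply/invE; exists lab; apply: represents_transitive repr.
  have le_time : (k * n).+1 * (time output_body + 3 + 10) <=
      (n ^ 2).+1 * (k.+1 * (time output_body + 3 + 10)).
    by rewrite mulnA leq_mul2r; apply/orP; right; nia.
  move=> _; apply: halts_seq_scale (halts_weaken le_time (fun _ => id) (output_loop r0 r2 a3)) _ => s3 memE.
  have k_lt : k < 2 ^ w by lia.
  apply: halts_seq_scale (halts_weaken (short _) (fun _ => id)
    (halts_assign (eval_const s3 k_lt) (erefl (set_reg s3 1 k)))) _ => _ <-.
  apply: halts_weaken (short _) (fun _ => id) _.
  apply: (halts_assign (eval_const _ word_gt1)); split=> [|_]; first by split.
  rewrite (_ : output_family _ _ = family_of n lab); first by rewrite size_mkseq.
  apply/eq_in_map => i; rewrite mem_iota add0n => /andP[_ ik].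
  apply/setP => j; rewrite !inE /=.
  have jn := ltn_ord j; have n0 : 0 < n by apply: leq_ltn_trans jn.
  have lt_kn : i * n + j < k * n.
    by apply: (@leq_trans (i.+1 * n)); rewrite ?leq_mul2r ?ik ?orbT // mulSnr ltn_add2l.
  by rewrite memE // modnMDl modn_small // divnMDl // divn_small // addn0 eqb0 negbK.
apply: (halts_if_scale (b := false)) => // _.
have le_time c : 2 <= (n ^ 2).+1 * (c + (2 + 2)).
  by apply: leq_trans (short _) ; lia.
apply: halts_weaken (le_time _) (fun _ => id) _.
apply: (halts_assign (v := 0)); first by rewrite /= mod0n.
by split=> [|/invE]; [split=> // /invE|].
Qed.

End Correctness.

(** With [u] the logarithm, each term is at most its coefficient times [2 ^ (2 * u)], and the
    coefficients 1, [k], 5 and [word_const] add up to less than [K]. Then [K < 2 ^ K] and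
    [K + 2 * u <= K * u.+1]. *)
Lemma word_bound n w : (word_const + k + 8) * (up_log 2 n).+1 <= w ->
  n * n + k * n + 5 * n + word_const <= 2 ^ w.
Proof.
set K := word_const + k + 8; set u := up_log 2 n => Kw.
have le_n : n <= 2 ^ u by apply: up_logP.
have P0 : 0 < 2 ^ u by rewrite expn_gt0.
apply: (@leq_trans (K * 2 ^ (2 * u))); last first.
  apply: (@leq_trans (2 ^ (K + 2 * u))).
    by rewrite expnD leq_mul2r (ltnW (ltn_expl _ _)) ?orbT.
  rewrite leq_exp2l //; apply: leq_trans Kw; rewrite mulnS leq_add2l leq_mul2r /K.
  by apply/orP; right; lia.
have le_P : 2 ^ u <= 2 ^ (2 * u) by rewrite leq_exp2l // leq_pmull.
have le_nn : n * n <= 2 ^ (2 * u) by rewrite mulSn mul1n expnD leq_mul.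
have le_n2 := leq_trans le_n le_P.
have le_kn : k * n <= k * 2 ^ (2 * u) by rewrite leq_mul2l le_n2 orbT.
have le_c : word_const <= word_const * 2 ^ (2 * u) by rewrite leq_pmulr ?expn_gt0.
move: le_nn le_n2 le_kn le_c; rewrite /K !mulnDl; move: (2 ^ (2 * u)) => X; clear; lia.
Qed.

Lemma inversion_algorithm_quadratic : solves_in_time (fun n => n ^ 2)
  (fun n T s => decides_inversion k T s /\ finds_family k T s) inversion_algorithm.
Proof.
exists (word_const + k + 8), algorithm_cost => n T w torT /word_bound big_word.
have [t [s [ex le_t spec]]] := halts_algorithm torT big_word.
by exists t, s; split=> //; rewrite mulnC.
Qed.

End Algorithm.

Theorem theorem1p7 (k : nat) :
  (exists P : cmd,
     solves_in_time (fun n => n ^ 2) (@decides_inversion k) P) /\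
  (exists P : cmd,
     solves_in_time (fun n => n ^ 2)
       (fun n T s => decides_inversion k T s /\ finds_family k T s) P).
Proof.
have [c [C H]] := inversion_algorithm_quadratic k.
split; exists (inversion_algorithm k); exists c, C => // n T w torT le_w.
by have [t [s [ex le_t [dec _]]]] := H n T w torT le_w; exists t, s.
Qed.
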